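(* Let $\varphi$ be a formula in negative normal form and let $\mathcal{W}2\mathcal{S}(\varphi)$ be its Weak-to-Safety translation. For each trace $\pi$: \begin{itemize} \item If $\pi$ is an infinite trace: $\pi \models_{t^-} \varphi \Leftrightarrow \pi \models_{LTL} \varphi$. \item If $\pi$ is a finite trace: $\pi \models_{t^-} \varphi \Leftrightarrow \pi \models_{t^-} \mathcal{W}2\mathcal{S}(\varphi)$. \end{itemize}
   Context: The logic is first-order LTL with past operators ($Y$ ''yesterday'', $S$ ''since''), if-then-else terms, and event-freezing terms $u @\tilde{F} \varphi$ (''value of $u$ at the next point where $\varphi$ holds'') and $u @\tilde{P} \varphi$ (''value of $u$ at the last point where $\varphi$ holds''), interpreted over finite or infinite traces $\pi = s_0 s_1 \dots$ of assignments to input variables $V^I$ and output variables $V^O$ (in a finite trace the last assignment is over $V^O$ only). Abbreviations: $\varphi_1 R \varphi_2 := \neg(\neg\varphi_1 U \neg\varphi_2)$, $G\varphi := \neg(\top U \neg\varphi)$. The truncated semantics (after Eisner–Fisman) has a weak relation $\models_{t^-}$ and a strong relation $\models_{t^+}$; negation swaps them ($\pi,i \models_{t^-} \neg\varphi$ iff $\pi,i \not\models_{t^+}\varphi$ and vice versa). Under weak semantics, predicates over output variables hold at any position $i \ge |\pi|$, predicates over input variables (or containing $@\tilde{F}$ terms) hold at any position $i \ge |\pi|-1$; $X\varphi$ holds at $i$ iff $\varphi$ holds at $i+1$; $\varphi_1 U \varphi_2$ holds at $i$ iff there is $k \ge i$ with $\varphi_2$ at $k$ and $\varphi_1$ at all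 $l$ with $i \le l < k$; $Y\varphi$ holds weakly at $i$ iff $i \ge |\pi|$ or ($i>0$ and $\varphi$ holds weakly at $i-1$). Consequently every formula is weakly satisfied at positions beyond the end of a finite trace. $\pi \models_{t^-} \varphi$ means $\pi,0 \models_{t^-} \varphi$. On infinite traces the weak semantics coincides with standard LTL semantics ($\models_{LTL}$) with event-freezing functions. The Weak-to-Safety translation $\mathcal{W}2\mathcal{S}$, mapping formulas in negative normal form interpreted under weak semantics into the SafetyLTL fragment, is defined by: $\mathcal{W}2\mathcal{S}(Pred) := Pred$; $\mathcal{W}2\mathcal{S}(\neg Pred) := \neg Pred$; $\mathcal{W}2\mathcal{S}(\varphi_1 \vee \varphi_2) := \mathcal{W}2\mathcal{S}(\varphi_1) \vee \mathcal{W}2\mathcal{S}(\varphi_2)$; $\mathcal{W}2\mathcal{S}(\varphi_1 \wedge \varphi_2) := \mathcal{W}2\mathcal{S}(\varphi_1) \wedge \mathcal{W}2\mathcal{S}(\varphi_2)$; $\mathcal{W}2\mathcal{S}(X\varphi) := X\,\mathcal{W}2\mathcal{S}(\varphi)$; $\mathcal{W}2\mathcal{S}(Y\varphi) := Y\,\mathcal{W}2\mathcal{S}(\varphi)$; $\mathcal{W}2\mathcal{S}(\varphi_1 U \varphi_2) := \mathcal{W}2\mathcal{S}(\varphi_2) R (\mathcal{W}2\mathcal{S}(\varphi_1) \vee \mathcal{W}2\mathcal{S}(\varphi_2))$; $\mathcal{W}2\mathcal{S}(\varphi_1 R \varphi_2) := \mathcal{W}2\mathcal{S}(\varphi_1)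 R\, \mathcal{W}2\mathcal{S}(\varphi_2)$. *)

(* Defs.v *)
From mathcomp Require Import all_boot.
From mathcomp Require Import boolp.

Set Implicit Arguments.
Unset Strict Implicit.
Unset Printing Implicit Defensive.

(* Single-sorted first-order signature, with the input variables V^I and the
   output variables V^O; constants are the function symbols of arity 0. *)
Record signature := Signature {
  fsym : Type;
  farity : fsym -> nat;
  psym : Type;
  parity : psym -> nat;
  ivar : Type;
  ovar : Type
}.

Inductive formula (Sg : signature) : Type :=
| FTop
| FPred (p : psym Sg) (us : 'I_(parity p) -> term Sg)
| FNot (phi : formula Sg)
| FAnd (phi1 phi2 : formula Sg)
| FOr (phi1 phi2 : formula Sg)
| FNext (phi : formula Sg)
| FUntil (phi1 phi2 : formula Sg)
| FYesterday (phi : formula Sg)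
| FSince (phi1 phi2 : formula Sg)
with term (Sg : signature) : Type :=
| TIn (x : ivar Sg)
| TOut (y : ovar Sg)
| TFun (f : fsym Sg) (us : 'I_(farity f) -> term Sg)
| TIte (phi : formula Sg) (u1 u2 : term Sg)
| TAtNext (u : term Sg) (phi : formula Sg)
| TAtLast (u : term Sg) (phi : formula Sg).

Arguments FTop {Sg}.
Arguments FPred {Sg} p us.
Arguments TIn {Sg} x.
Arguments TOut {Sg} y.
Arguments TFun {Sg} f us.

Notation FRelease phi1 phi2 := (FNot (FUntil (FNot phi1) (FNot phi2))).
Notation FGlobally phi := (FNot (FUntil FTop (FNot phi))).

(* [uses_input_or_next_term u]: an input variable or an at-next term occurs in
   [u], possibly inside a formula nested in [u]. *)
Fixpoint uses_input_or_next (Sg : signature) (phi : formula Sg) : Prop :=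
  match phi with
  | FTop => False
  | FPred p us => exists j, uses_input_or_next_term (us j)
  | FNot a | FNext a | FYesterday a => uses_input_or_next a
  | FAnd a b | FOr a b | FUntil a b | FSince a b =>
      uses_input_or_next a \/ uses_input_or_next b
  end
with uses_input_or_next_term (Sg : signature) (u : term Sg) : Prop :=
  match u with
  | TIn _ => True
  | TOut _ => False
  | TFun f us => exists j, uses_input_or_next_term (us j)
  | TIte a v w => [\/ uses_input_or_next a, uses_input_or_next_term v
                    | uses_input_or_next_term w]
  | TAtNext _ _ => True
  | TAtLast v a => uses_input_or_next_term v \/ uses_input_or_next a
  end.

(* [default u] is the value def_u of a freezing term whose event does not occur;
   it also serves as the value of a variable at the positions where a finite
   trace does not assign it. *)
Record structure (Sg : signature) := Structure {
  dom : Type;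
  fint : forall f : fsym Sg, (farity f).-tuple dom -> dom;
  pint : forall p : psym Sg, (parity p).-tuple dom -> Prop;
  default : term Sg -> dom
}.

Section Semantics.
Variables (Sg : signature) (M : structure Sg).

Definition iassign := ivar Sg -> dom M.
Definition oassign := ovar Sg -> dom M.
Definition assignment := (iassign * oassign)%type.

(* [FinTrace s o] is the trace of length (size s).+1 whose last assignment [o]
   is over the output variables only. *)
Inductive trace :=
| FinTrace (s : seq assignment) (o : oassign)
| InfTrace (w : nat -> assignment).

(* i >= |pi| *)
Definition past_end (pi : trace) (i : nat) : bool :=
  if pi is FinTrace s _ then (size s).+1 <= i else false.

Definition ival (pi : trace) (i : nat) (x : ivar Sg) : dom M :=
  match pi with
  | FinTrace s _ => if onth s i is Some a then a.1 x else default M (TIn x)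
  | InfTrace w => (w i).1 x
  end.

Definition oval (pi : trace) (i : nat) (y : ovar Sg) : dom M :=
  match pi with
  | FinTrace s o =>
      if onth s i is Some a then a.2 y
      else if i == size s then o y else default M (TOut y)
  | InfTrace w => (w i).2 y
  end.

(* Both freezing operators are strict: the present position is skipped. *)
Definition next_point (P : nat -> Prop) (i k : nat) : Prop :=
  [/\ i < k, P k & forall l, i < l < k -> ~ P l].
Definition last_point (P : nat -> Prop) (i k : nat) : Prop :=
  [/\ k < i, P k & forall l, k < l < i -> ~ P l].

Definition freeze (R : nat -> nat -> Prop) (u : nat -> dom M) (d : dom M)
    (i : nat) : dom M :=
  if pselect (exists k, R i k) is left ex then u (sval (cid ex)) else d.

Fixpoint ltl (w : nat -> assignment) (phi : formula Sg) (i : nat) : Prop :=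
  match phi with
  | FTop => True
  | FPred p us => pint (p := p) [tuple ltl_eval w (us j) i | j < parity p]
  | FNot a => ~ ltl w a i
  | FAnd a b => ltl w a i /\ ltl w b i
  | FOr a b => ltl w a i \/ ltl w b i
  | FNext a => ltl w a i.+1
  | FUntil a b =>
      exists k, [/\ i <= k, ltl w b k & forall l, i <= l < k -> ltl w a l]
  | FYesterday a => 0 < i /\ ltl w a i.-1
  | FSince a b =>
      exists k, [/\ k <= i, ltl w b k & forall l, k < l <= i -> ltl w a l]
  end
with ltl_eval (w : nat -> assignment) (u : term Sg) (i : nat) : dom M :=
  match u with
  | TIn x => (w i).1 x
  | TOut y => (w i).2 y
  | TFun f us => fint (f := f) [tuple ltl_eval w (us j) i | j < farity f]
  | TIte a v v' => if pselect (ltl w a i) then ltl_eval w v i else ltl_eval w v' i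
  | TAtNext v a => freeze (next_point (ltl w a)) (ltl_eval w v) (default M u) i
  | TAtLast v a => freeze (last_point (ltl w a)) (ltl_eval w v) (default M u) i
  end.

Inductive view := Weak | Strong.

Definition dual (v : view) : view :=
  match v with Weak => Strong | Strong => Weak end.

(* How a view treats a clause [P] when [e] says that the trace is exhausted. *)
Definition truncate (v : view) (e P : Prop) : Prop :=
  match v with Weak => e \/ P | Strong => ~ e /\ P end.

(* [tsat Weak] is |=_{t-} and [tsat Strong] is |=_{t+}.  The constant top is
   treated as a 0-ary output predicate: this is what makes every formula,
   including its negation, weakly true beyond the end of a finite trace.  The
   event of a freezing term is only sought among the positions of the trace. *)
Fixpoint tsat (v : view) (pi : trace) (phi : formula Sg) (i : nat) : Prop :=
  match phi with
  | FTop => truncate v (past_end pi i) True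
  | FPred p us =>
      truncate v
        (past_end pi i \/
         (exists j, uses_input_or_next_term (us j)) /\ past_end pi i.+1)
        (pint (p := p) [tuple teval v pi (us j) i | j < parity p])
  | FNot a => ~ tsat (dual v) pi a i
  | FAnd a b => tsat v pi a i /\ tsat v pi b i
  | FOr a b => tsat v pi a i \/ tsat v pi b i
  | FNext a => tsat v pi a i.+1
  | FUntil a b =>
      exists k,
        [/\ i <= k, tsat v pi b k & forall l, i <= l < k -> tsat v pi a l]
  | FYesterday a => truncate v (past_end pi i) (0 < i /\ tsat v pi a i.-1)
  | FSince a b =>
      truncate v (past_end pi i)
        (exists k,
          [/\ k <= i, tsat v pi b k & forall l, k < l <= i -> tsat v pi a l])
  end
with teval (v : view) (pi : trace) (u : term Sg) (i : nat) : dom M :=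
  match u with
  | TIn x => ival pi i x
  | TOut y => oval pi i y
  | TFun f us => fint (f := f) [tuple teval v pi (us j) i | j < farity f]
  | TIte a t t' =>
      if pselect (tsat v pi a i) then teval v pi t i else teval v pi t' i
  | TAtNext t a =>
      freeze (next_point (fun k => ~~ past_end pi k /\ tsat v pi a k))
        (teval v pi t) (default M u) i
  | TAtLast t a =>
      freeze (last_point (fun k => ~~ past_end pi k /\ tsat v pi a k))
        (teval v pi t) (default M u) i
  end.

Definition models_ltl (w : nat -> assignment) (phi : formula Sg) := ltl w phi 0.
Definition models_weak (pi : trace) (phi : formula Sg) := tsat Weak pi phi 0.

End Semantics.

Arguments FinTrace {Sg M} s o.
Arguments InfTrace {Sg M} w.

Inductive nnf (Sg : signature) : formula Sg -> Prop :=
| nnf_top : nnf FTop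
| nnf_ntop : nnf (FNot FTop)
| nnf_pred p us : nnf (FPred p us)
| nnf_npred p us : nnf (FNot (FPred p us))
| nnf_or a b : nnf a -> nnf b -> nnf (FOr a b)
| nnf_and a b : nnf a -> nnf b -> nnf (FAnd a b)
| nnf_next a : nnf a -> nnf (FNext a)
| nnf_yesterday a : nnf a -> nnf (FYesterday a)
| nnf_since a b : nnf a -> nnf b -> nnf (FSince a b)
| nnf_until a b : nnf a -> nnf b -> nnf (FUntil a b)
| nnf_release a b : nnf a -> nnf b -> nnf (FRelease a b).

(* Meaningful on [nnf] formulas only.  The published translation has no clause
   for "since" (nor for top, an atom here); the one below follows "yesterday". *)
Fixpoint W2S (Sg : signature) (phi : formula Sg) : formula Sg :=
  match phi with
  | FTop => FTop
  | FNot FTop => FNot FTop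
  | FPred p us => FPred p us
  | FNot (FPred p us) => FNot (FPred p us)
  | FOr a b => FOr (W2S a) (W2S b)
  | FAnd a b => FAnd (W2S a) (W2S b)
  | FNext a => FNext (W2S a)
  | FYesterday a => FYesterday (W2S a)
  | FSince a b => FSince (W2S a) (W2S b)
  | FUntil a b => FRelease (W2S b) (FOr (W2S a) (W2S b))
  | FRelease a b => FRelease (W2S a) (W2S b)
  | _ => phi
  end.

(* Main.v *)
Require Import Defs.
From mathcomp Require Import all_boot.
From mathcomp Require Import boolp.

(** On an infinite trace no position is past the end, so the weak and the strong
    relation collapse to the LTL one.  On a finite trace every formula is weakly
    true past the end; hence the right argument of an until always holds at some
    later position, and [a U b] cannot be told apart from its weak version
    [b R (a \/ b)]. *)

(* Formulas also occur inside terms, as conditions and as events to freeze at, so the collapse on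
   infinite traces is proved for both sorts at once. *)
Scheme formula_term_ind := Induction for formula Sort Prop
  with term_formula_ind := Induction for term Sort Prop.

Lemma truncate_false (v : view) (P : Prop) : truncate v false P = P.
Proof.
case: v; apply/propext; split=> /=.
- by case.
- by right.
- by case.
- by split.
Qed.

Section WeakSemantics.
Set Implicit Arguments.
Unset Strict Implicit.
Variables (Sg : signature) (M : structure Sg).
Implicit Types (a b phi : formula Sg) (pi : trace M) (v : view).

(** Keeping [v] general in the induction absorbs the swap of views at negations. Equating functions
    of the position lets the hypotheses rewrite under binders and inside [freeze]. *)
Lemma tsat_InfTrace (w : nat -> assignment M) phi v :
  tsat v (InfTrace w) phi = ltl w phi.
Proof.
move: phi v; apply: (@formula_term_ind Sg
  (fun a => forall v, tsat v (InfTrace w) a = ltl w a)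
  (fun u => forall v, teval v (InfTrace w) u = ltl_eval w u)) => /=.
- by move=> v; apply/funext => i; rewrite truncate_false.
- move=> p us IH v; apply/funext => i.
  have -> : (false \/ (exists j, uses_input_or_next_term (us j)) /\ false)
             = (false : Prop).
    by apply/propext; split=> [[|[]]|].
  rewrite truncate_false; congr (pint _).
  by apply: eq_from_tnth => j; rewrite !tnth_mktuple IH.
- by move=> a IH v; apply/funext => i; rewrite IH.
- by move=> a IHa b IHb v; apply/funext => i; rewrite IHa IHb.
- by move=> a IHa b IHb v; apply/funext => i; rewrite IHa IHb.
- by move=> a IH v; apply/funext => i; rewrite IH.
- by move=> a IHa b IHb v; apply/funext => i; rewrite IHa IHb.
- by move=> a IH v; apply/funext => i; rewrite truncate_false IH.
- by move=> a IHa b IHb v; apply/funext => i; rewrite truncate_false IHa IHb.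
- by [].
- by [].
- move=> f us IH v; apply/funext => i; congr (fint _).
  by apply: eq_from_tnth => j; rewrite !tnth_mktuple IH.
- by move=> a IHa u IHu u' IHu' v; apply/funext => i; rewrite IHa IHu IHu'.
- move=> u IHu a IHa v; apply/funext => i; rewrite IHa IHu.
  (* What still differs is the guard that the event lies within the trace, trivially true here. *)
  congr (freeze (next_point _) _ _ _); apply/funext => k.
  by apply/propext; split=> [[]|].
- move=> u IHu a IHa v; apply/funext => i; rewrite IHa IHu.
  congr (freeze (last_point _) _ _ _); apply/funext => k.
  by apply/propext; split=> [[]|].
Qed.

Lemma past_end_mono pi i k : i <= k -> past_end pi i -> past_end pi k.
Proof. by case: pi => //= s o ik /leq_trans; apply. Qed.

(** The two halves are proved together because negation exchanges them. Truncation settles the atoms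
    without evaluating their terms, so induction on formulas alone suffices. *)
Lemma tsat_past_end pi phi i : past_end pi i ->
  tsat Weak pi phi i /\ ~ tsat Strong pi phi i.
Proof.
elim: phi i => [|p us|a IH|a IHa b IHb|a IHa b IHb|a IH|a IHa b IHb|a IH
               |a IHa b IHb] i pe /=.
- by split; [left | case].
- by split; [left; left | case=> + _; apply; left].
- by have [? ?] := IH i pe; split => // /(_ _).
- by have [? ?] := IHa i pe; have [? ?] := IHb i pe; split=> // -[].
- have [? ?] := IHa i pe; have [? ?] := IHb i pe.
  by split; [left | case].
- exact: IH _ (past_end_mono (leqnSn i) pe).
(* Strongly, any witness [k] would lie past the end, where [b] fails; weakly, [i] itself is a
   witness, with an empty range left for [a]. *)
- split; last by case=> k [ik /(IHb k (past_end_mono ik pe)).2].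
  exists i; split=> //; first exact: (IHb i pe).1.
  by move=> l /andP[il] /(leq_ltn_trans il); rewrite ltnn.
- by split; [left | case].
- by split; [left | case].
Qed.

(** The outer and inner negations swap the view twice, so [a] and [b] are again read weakly; the
    rest is classical duality. *)
Lemma tsat_weak_release pi a b i :
  tsat Weak pi (FRelease a b) i <->
  forall k, i <= k ->
    tsat Weak pi b k \/ exists2 l, i <= l < k & tsat Weak pi a l.
Proof.
split=> [rel k ik|rel [k [ik nb na]]].
  apply: contrapT => /not_orP[nb na]; apply: rel; exists k; split=> //= l ilk al.
  by apply: na; exists l.
by have [//|[l ilk al]] := rel k ik; case: (na l ilk).
Qed.

(* The witness of the until is the first position where [B] holds. *)
Lemma until_release (A B : nat -> Prop) i : (exists2 k, i <= k & B k) ->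
  (exists k, [/\ i <= k, B k & forall l, i <= l < k -> A l]) <->
  (forall k, i <= k -> (A k \/ B k) \/ exists2 l, i <= l < k & B l).
Proof.
move=> exB; split=> [[k0 [ik0 Bk0 Ak0]] k ik|rel].
  have [kk0|k0k|->] := ltngtP k k0; last by left; right.
    by left; left; apply: Ak0; rewrite ik.
  by right; exists k0; rewrite ?ik0.
have exB' : exists k, (i <= k) && `[< B k >].
  by case: exB => k ik Bk; exists k; rewrite ik; apply/asboolP.
case: (ex_minnP exB') => k /andP[ik /asboolP Bk] kmin.
exists k; split=> // l /andP[il lk].
(* By minimality of [k], only the disjunct [A l] of the release condition at [l] can hold. *)
have notB m : i <= m -> m < k -> ~ B m.
  by move=> im + Bm; rewrite ltnNge kmin ?im //; apply/asboolP.
have [[//|/(notB l il lk)//]|[m /andP[im ml] /notB[]//]] := rel l il.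
exact: ltn_trans lk.
Qed.

(** All operators but until are translated homomorphically, so until is the only case that goes
    beyond rewriting. *)
Lemma tsat_weak_W2S (s : seq (assignment M)) (o : oassign M) phi : nnf phi ->
  tsat Weak (FinTrace s o) (W2S phi) = tsat Weak (FinTrace s o) phi.
Proof.
elim=> // {phi} [a b _ IHa _ IHb|a b _ IHa _ IHb|a _ IHa|a _ IHa
  |a b _ IHa _ IHb|a b _ IHa _ IHb|a b _ IHa _ IHb]; apply/funext => i.
- by rewrite /= IHa IHb.
- by rewrite /= IHa IHb.
- by rewrite /= IHa.
- by rewrite /= IHa.
- by rewrite /= IHa IHb.
- rewrite [W2S _]/=; apply/propext; apply: iff_trans (tsat_weak_release _ _ _ _) _.
  rewrite /= IHa IHb; apply: iff_sym; apply: until_release.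
  (* The trace has length [(size s).+1], so this position is both at least [i] and past the end. *)
  exists (maxn i (size s).+1); first exact: leq_maxl.
  by apply: (tsat_past_end _ _).1; rewrite /= leq_maxr.
- by rewrite /= IHa IHb.
Qed.

End WeakSemantics.

Theorem theorem3p8 (Sg : signature) (M : structure Sg) (phi : formula Sg)
    (Hnnf : nnf phi) :
  (forall w : nat -> assignment M,
      models_weak (InfTrace w) phi <-> models_ltl w phi) /\
  (forall (s : seq (assignment M)) (o : oassign M),
      models_weak (FinTrace s o) phi <-> models_weak (FinTrace s o) (W2S phi)).
Proof.
by split=> [w|s o]; rewrite /models_weak /models_ltl
  ?tsat_InfTrace ?tsat_weak_W2S.
Qed.
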